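(* Let $(p,\mathcal E)$ be a framework in $\mathbb R^d$ with data $\mathcal C,\mathcal V,\omega,\lambda,\kappa,\mu_0,L,\bar\mu$ as described in the context. Define $$\eta_1=\frac{4|\omega^TR(p)|}{\lambda},\qquad D=\frac{\eta_1}{L}\Big(\bar\mu^{1/2}+\frac{\eta_1}{L}\Big).$$ Suppose $D<\frac12$. Then any continuous path $q(t)\in\mathcal C^p$ with $q(0)=p$ which preserves the edge lengths of $p$ (i.e. $|q_i(t)-q_j(t)|=|p_i-p_j|$ for all $(i,j)\in\mathcal E$ and all $t$) satisfies $|q(t)-p|\le\eta_1$ for all $t$.
   Context: A framework $(p,\mathcal E)$ in $\mathbb R^d$ consists of a configuration $p=(p_1,\dots,p_n)\in\mathbb R^{dn}$, $p_i\in\mathbb R^d$, and the set $\mathcal E$ of $m$ edges of a graph on vertices $1,\dots,n$. $|\cdot|$ is the Euclidean norm. For $q\in\mathbb R^{dn}$ the rigidity matrix $R(q)\in\mathbb R^{m\times dn}$ is defined by: the $(i,j)$-component of $R(q)u$ is $(q_i-q_j)\cdot(u_i-u_j)$ for $u\in\mathbb R^{dn}$, $(i,j)\in\mathcal E$. A stress is a vector $\omega\in\mathbb R^m$ with components $\omega_{ij}$; its stress matrix $\Omega=\Omega(\omega)\in\mathbb R^{dn\times dn}$ is the symmetric matrix with $u^T\Omega v=\sum_{(i,j)\in\mathcal E}\omega_{ij}(u_i-u_j)\cdot(v_i-v_j)$. $\mathcal T(p)$ is the space of trivial flexes at $p$ (velocities of infinitesimal rigid-body motions, $v_i=Ap_i+b$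 with $A$ skew-symmetric, $b\in\mathbb R^d$). Data: $\mathcal C\subset\mathbb R^{dn}$ is a linear subspace complementary to $\mathcal T(p)$, and $\mathcal C^p=\{p+v:v\in\mathcal C\}$. $\mathcal V$ is a linear subspace with $\mathrm{Null}(R(p))\cap\mathcal C\subset\mathcal V\subset\mathcal C$. $\omega\in\mathbb R^m$ is a stress such that $V^T\Omega V\succ0$, where the columns of $V$ are an orthonormal basis of $\mathcal V$. Let $C$ be a matrix whose columns form an orthonormal basis of $\mathcal C$. Let $\lambda_0=\lambda_{\min}(V^T\Omega V)$ ($\lambda_0=+\infty$ if $\mathcal V=\{0\}$, in which case the condition on $\omega$ is vacuous) and $\mu_0=\lambda_{\min}(C^T\Omega C)$, where $\lambda_{\min}$ is the smallest eigenvalue. Choose $\lambda\in(0,\lambda_0)$, and let $\kappa$ be the smallest $\kappa\ge0$ such that $C^T\Omega C+2\kappa C^TR(p)^TR(p)C\succeq\lambda I$ (it exists). Let $z$ be the maximum degree of a vertex of the graph, and $L=\left(\frac{\lambda}{8z\kappa}\right)^{1/2}$, $\bar\mu=1-\frac{\mu_0}{\lambda}$. If $\kappa=0$ then $L=+\infty$ and all terms with a factor $1/L$ are $0$ (so $D=0$). *)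

(* Defs.v *)
From HB Require Import structures.
From mathcomp Require Import all_boot all_order all_algebra.
From mathcomp Require Import all_classical all_reals all_analysis.

Set Implicit Arguments.
Unset Strict Implicit.
Unset Printing Implicit Defensive.

Import Order.TTheory GRing.Theory Num.Theory.
Import numFieldNormedType.Exports.

Local Open Scope classical_set_scope.
Local Open Scope ring_scope.

(* Euclidean norm of a row or column vector; the norm `|A| that
   mathcomp-analysis puts on matrices is the sup norm. *)
Definition enorm (R : realType) (k l : nat) (A : 'M[R]_(k, l)) : R :=
  Num.sqrt (\sum_(i < k) \sum_(j < l) A i j ^+ 2).

Definition dot (R : realType) (k : nat) (u v : 'cV[R]_k) : R :=
  \sum_(a < k) u a 0 * v a 0.

(* Meant for symmetric B. *)
Definition psd (R : realType) (k : nat) (B : 'M[R]_k) : Prop :=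
  forall x : 'cV[R]_k, 0 <= (x^T *m B *m x) 0 0.

Definition posdef (R : realType) (k : nat) (B : 'M[R]_k) : Prop :=
  forall x : 'cV[R]_k, x != 0 -> 0 < (x^T *m B *m x) 0 0.

(* Smallest eigenvalue of a symmetric matrix. The set of eigenvalues is finite,
   so the infimum is attained unless k = 0, in which case it is +oo. *)
Definition lambda_min (R : realType) (k : nat) (B : 'M[R]_k) : \bar R :=
  ereal_inf [set a%:E | a in [set a : R | eigenvalue B a]].

Definition orthonormal_basis (R : realType) (k : nat) (U : {vspace 'cV[R]_k})
    (B : 'M[R]_(k, \dim U)) : Prop :=
  B^T *m B = 1%:M /\ basis_of U [seq col j B | j <- enum 'I_(\dim U)].

(* The graph is given by its (symmetric, irreflexive) adjacency relation G;
   each undirected edge is listed once, as the pair (i, j) with i < j. *)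
Definition edges (n : nat) (G : rel 'I_n) : {set 'I_n * 'I_n} :=
  [set e : 'I_n * 'I_n | (e.1 < e.2)%N && G e.1 e.2].

Notation nedges G := #|edges G|.

Definition edge (n : nat) (G : rel 'I_n) (k : 'I_(nedges G)) : 'I_n * 'I_n :=
  enum_val k.

Definition max_degree (n : nat) (G : rel 'I_n) : nat :=
  \max_(i < n) #|[set j | G i j]|.

Definition pt (R : realType) (n d : nat) (q : 'cV[R]_(n * d)) (i : 'I_n) :
    'cV[R]_d :=
  \col_a q (mxvec_index i a) 0.

Definition ediff (R : realType) (n d : nat) (G : rel 'I_n)
    (q : 'cV[R]_(n * d)) (k : 'I_(nedges G)) : 'cV[R]_d :=
  pt q (edge k).1 - pt q (edge k).2.

(* Both matrices are built from their action on the standard basis; see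
   rigidity_mxE and stress_mxE. *)
Definition rigidity_mx (R : realType) (n d : nat) (G : rel 'I_n)
    (q : 'cV[R]_(n * d)) : 'M[R]_(nedges G, n * d) :=
  \matrix_(k, a) dot (ediff q k) (ediff (delta_mx a 0) k).

Definition stress_mx (R : realType) (n d : nat) (G : rel 'I_n)
    (omega : 'cV[R]_(nedges G)) : 'M[R]_(n * d) :=
  \matrix_(a, b) \sum_k omega k 0 *
    dot (ediff (delta_mx a 0) k) (ediff (delta_mx b 0) k).

Lemma ediffE (R : realType) (n d : nat) (G : rel 'I_n)
    (u : 'cV[R]_(n * d)) (k : 'I_(nedges G)) :
  ediff u k = \sum_a u a 0 *: ediff (delta_mx a 0) k.
Proof.
have ptE i : pt u i = \sum_a u a 0 *: pt (delta_mx a 0) i.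
  apply/colP => b; rewrite summxE !mxE (bigD1 (mxvec_index i b)) //= !mxE !eqxx.
  rewrite mulr1 big1 ?addr0 // => c; rewrite eq_sym => /negbTE cb.
  by rewrite !mxE cb mulr0.
by rewrite /ediff !ptE -sumrB; apply: eq_bigr => a _; rewrite scalerBr.
Qed.

Lemma dot_sumr (R : realType) (k m : nat) (u : 'cV[R]_k) (c : 'I_m -> R)
    (w : 'I_m -> 'cV[R]_k) :
  dot u (\sum_a c a *: w a) = \sum_a c a * dot u (w a).
Proof.
rewrite /dot; under eq_bigr do rewrite summxE mulr_sumr.
rewrite exchange_big; apply: eq_bigr => a _; rewrite mulr_sumr.
by apply: eq_bigr => b _; rewrite mxE mulrCA.
Qed.

Lemma dotC (R : realType) (k : nat) (u v : 'cV[R]_k) : dot u v = dot v u.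
Proof. by apply: eq_bigr => a _; rewrite mulrC. Qed.

Lemma rigidity_mxE (R : realType) (n d : nat) (G : rel 'I_n)
    (q u : 'cV[R]_(n * d)) (k : 'I_(nedges G)) :
  (rigidity_mx G q *m u) k 0 =
  dot (pt q (edge k).1 - pt q (edge k).2) (pt u (edge k).1 - pt u (edge k).2).
Proof.
rewrite -/(ediff q k) -/(ediff u k) (ediffE u) dot_sumr mxE.
by apply: eq_bigr => a _; rewrite mxE mulrC.
Qed.

Lemma stress_mxE (R : realType) (n d : nat) (G : rel 'I_n)
    (omega : 'cV[R]_(nedges G)) (u v : 'cV[R]_(n * d)) :
  (u^T *m stress_mx d omega *m v) 0 0 =
  \sum_k omega k 0 * dot (pt u (edge k).1 - pt u (edge k).2)
                         (pt v (edge k).1 - pt v (edge k).2).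
Proof.
under [RHS]eq_bigr => k _.
  rewrite -/(ediff u k) -/(ediff v k) (ediffE v) dot_sumr mulr_sumr.
  under eq_bigr do rewrite (ediffE u) dotC dot_sumr !mulr_sumr.
  over.
rewrite exchange_big mxE; apply: eq_bigr => b _.
rewrite mxE mulr_suml exchange_big; apply: eq_bigr => a _.
rewrite !mxE mulr_sumr mulr_suml; apply: eq_bigr => k _.
by rewrite (dotC (ediff (delta_mx b 0) k)) mulrC [RHS]mulrCA; congr (_ * _);
  apply: mulrCA.
Qed.

Lemma stress_mx_sym (R : realType) (n d : nat) (G : rel 'I_n)
    (omega : 'cV[R]_(nedges G)) : (stress_mx d omega)^T = stress_mx d omega.
Proof.
by apply/matrixP => a b; rewrite !mxE; apply: eq_bigr => k _; rewrite dotC.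
Qed.

Definition trivial_flexes (R : realType) (n d : nat) (p : 'cV[R]_(n * d)) :
    set 'cV[R]_(n * d) :=
  [set v | exists (A : 'M[R]_d) (b : 'cV[R]_d),
     A^T = - A /\ forall i, pt v i = A *m pt p i + b].

Definition complementary (R : realType) (k : nat) (U : {vspace 'cV[R]_k})
    (T : set 'cV[R]_k) : Prop :=
  (forall v, v \in U -> T v -> v = 0) /\
  (forall x, exists v w, [/\ v \in U, T w & x = v + w]).

Definition translate (R : realType) (k : nat) (p : 'cV[R]_k)
    (U : {vspace 'cV[R]_k}) : set 'cV[R]_k :=
  [set p + v | v in [set v | v \in U]].

Definition kappa_admissible (R : realType) (n d : nat) (G : rel 'I_n)
    (p : 'cV[R]_(n * d)) (omega : 'cV[R]_(nedges G)) (m : nat)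
    (C : 'M[R]_(n * d, m)) (lambda kappa : R) : Prop :=
  0 <= kappa /\
  psd (C^T *m stress_mx d omega *m C
       + (2 * kappa) *: (C^T *m (rigidity_mx G p)^T *m rigidity_mx G p *m C)
       - lambda%:M).

Definition is_min_kappa (R : realType) (n d : nat) (G : rel 'I_n)
    (p : 'cV[R]_(n * d)) (omega : 'cV[R]_(nedges G)) (m : nat)
    (C : 'M[R]_(n * d, m)) (lambda kappa : R) : Prop :=
  kappa_admissible p omega C lambda kappa /\
  forall kappa', kappa_admissible p omega C lambda kappa' -> kappa <= kappa'.

Definition Lscale (R : realType) (z : nat) (lambda kappa : R) : \bar R :=
  if kappa == 0 then +oo%E
  else (Num.sqrt (lambda / (8 * z%:R * kappa)))%:E.

(* mu0 is infinite only if the subspace complementary to the trivial flexes is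
   {0}; then kappa = 0, and mubar enters only multiplied by 1/L = 0. *)
Definition mubar (R : realType) (mu0 : \bar R) (lambda : R) : R :=
  1 - fine mu0 / lambda.

(* 1/L, with 1/+oo = 0. *)
Definition Linv (R : realType) (L : \bar R) : R :=
  if L is r%:E then r^-1 else 0.

(* Main.v *)
Require Import Defs.
From HB Require Import structures.
From mathcomp Require Import all_boot all_order all_algebra.
From mathcomp Require Import all_classical all_reals all_analysis.
From mathcomp Require Import ring lra.

Set Implicit Arguments.
Unset Strict Implicit.
Unset Printing Implicit Defensive.

Import Order.TTheory GRing.Theory Num.Theory.
Import numFieldNormedType.Exports.

Local Open Scope classical_set_scope.
Local Open Scope ring_scope.

(** Let [v = q t - p], a vector of the subspace [CC], and write [v_e], [p_e] for
    the differences of [v] and [p] along an edge [e].  Keeping the length of [e]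
    means [2 * p_e . v_e + |v_e|^2 = 0].  Read as a formula for the entries of
    [rigidity_mx G p *m v], and summed with the weights [omega], this gives
      [|R(p) v|^2 = 1/4 * sum_e |v_e|^4]  and
      [v^T Omega v = - 2 * omega^T R(p) v].
    Substituting both in [lambda * |v|^2 <= v^T Omega v + 2 kappa |R(p) v|^2],
    which is the admissibility of [kappa], and using Cauchy-Schwarz for the first
    term and [sum_e |v_e|^4 <= 4 z |v|^4] for the second, one gets
      [lambda * |v|^2 <= 2 |omega^T R(p)| |v| + 2 z kappa |v|^4]
    (lemma [preserving_growth]).  In terms of [eta1] and [L] this reads
      [|v| <= eta1 / 2 + |v|^3 / (4 L^2)],
    so [|v| <= L] forces [|v| <= 2/3 * eta1].  In other words no length-preserving
    displacement in [CC] has a norm in the gap [(eta1, L]].  The hypothesis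
    [D < 1/2] bounds [(eta1 / L)^2] by [1/2], hence [eta1 < L]: the gap is not
    empty, and a continuous path starting at norm [0] cannot jump across it. *)

(** * Euclidean geometry of column vectors *)

Lemma dot_ge0 (R : realType) (k : nat) (u : 'cV[R]_k) : 0 <= dot u u.
Proof. by apply: sumr_ge0 => a _; rewrite -expr2 sqr_ge0. Qed.

Lemma dot_mulmx (R : realType) (k : nat) (u v : 'cV[R]_k) :
  dot u v = (u^T *m v) 0 0.
Proof. by rewrite mxE; apply: eq_bigr => a _; rewrite mxE. Qed.

Lemma dot_sqrD (R : realType) (k : nat) (u v : 'cV[R]_k) :
  dot (u + v) (u + v) = dot u u + 2 * dot u v + dot v v.
Proof.
rewrite /dot mulr_sumr -!big_split /=; apply: eq_bigr => a _; rewrite !mxE.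
by ring.
Qed.

Lemma dot_sqrB_le (R : realType) (k : nat) (u v : 'cV[R]_k) :
  dot (u - v) (u - v) <= 2 * (dot u u + dot v v).
Proof.
rewrite /dot -big_split mulr_sumr; apply: ler_sum => a _; rewrite !mxE /=.
by have := sqr_ge0 (u a 0 + v a 0); nra.
Qed.

Lemma enorm_ge0 (R : realType) (k l : nat) (A : 'M[R]_(k, l)) : 0 <= enorm A.
Proof. exact: sqrtr_ge0. Qed.

Lemma sqr_enorm (R : realType) (k : nat) (u : 'cV[R]_k) :
  enorm u ^+ 2 = dot u u.
Proof.
have E : \sum_(i < k) \sum_(j < 1) u i j ^+ 2 = dot u u.
  by apply: eq_bigr => i _; rewrite big_ord1 expr2.
by rewrite sqr_sqrtr E ?dot_ge0.
Qed.

Lemma enorm_trmx (R : realType) (k l : nat) (A : 'M[R]_(k, l)) :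
  enorm A^T = enorm A.
Proof.
rewrite /enorm exchange_big; congr Num.sqrt; apply: eq_bigr => i _.
by apply: eq_bigr => j _; rewrite mxE.
Qed.

(** With [s = dot a b] and [y = dot b b], the vector [y *: a - s *: b] has
    squared norm [y * (dot a a * y - s ^+ 2)]. *)
Lemma dot_cauchy_schwarz (R : realType) (k : nat) (a b : 'cV[R]_k) :
  dot a b ^+ 2 <= dot a a * dot b b.
Proof.
have E (y s : R) : \sum_i (y * a i 0 - s * b i 0) ^+ 2 =
    y ^+ 2 * dot a a - 2 * y * s * dot a b + s ^+ 2 * dot b b.
  rewrite /dot !mulr_sumr -sumrB -big_split /=; apply: eq_bigr => i _.
  by ring.
have [y_eq0|yneq0] := eqVneq (dot b b) 0.
  have b0 i : b i 0 = 0.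
    move/eqP: y_eq0; rewrite psumr_eq0 => [|j _];
      last by rewrite -expr2 sqr_ge0.
    by move=> /allP/(_ i (mem_index_enum _)); rewrite mulf_eq0 orbb => /eqP.
  have -> : dot a b = 0 by rewrite /dot big1 // => i _; rewrite b0 mulr0.
  by rewrite expr0n /= mulr_ge0 ?dot_ge0.
have : 0 <= dot b b * (dot a a * dot b b - dot a b ^+ 2).
  have -> : dot b b * (dot a a * dot b b - dot a b ^+ 2) =
      \sum_i (dot b b * a i 0 - dot a b * b i 0) ^+ 2 by rewrite E; ring.
  by apply: sumr_ge0 => i _; exact: sqr_ge0.
by rewrite pmulr_rge0 ?subr_ge0 // lt_def yneq0 dot_ge0.
Qed.

Lemma mulmx_enorm_le (R : realType) (k : nat) (w : 'rV[R]_k) (v : 'cV[R]_k) :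
  `|(w *m v) 0 0| <= enorm w * enorm v.
Proof.
rewrite -(@ler_pXn2r _ 2) ?nnegrE ?mulr_ge0 ?enorm_ge0 //.
rewrite real_normK ?num_real // exprMn -(enorm_trmx w) !sqr_enorm.
by rewrite -[w in w *m v]trmxK -dot_mulmx dot_cauchy_schwarz.
Qed.

Lemma enorm_continuous (R : realType) (k : nat) (p : 'cV[R]_k) :
  continuous (fun x : 'cV[R]_k => enorm (x - p)).
Proof.
have c i j : continuous (fun x : 'cV[R]_k => (x - p) i j ^+ 2).
  have -> : (fun x : 'cV[R]_k => (x - p) i j ^+ 2) =
      (fun z => (z - p i j) ^+ 2) \o (fun x : 'cV[R]_k => x i j).
    by apply/funext => x; rewrite /= !mxE.
  move=> x; apply: continuous_comp; first exact: coord_continuous.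
  apply: (@continuous_comp _ _ _ (fun z => z - p i j) (fun z => z ^+ 2)).
    by apply: cvgB; [exact: cvg_id|exact: cvg_cst].
  exact: exprn_continuous.
have csum : continuous
    (fun x : 'cV[R]_k => \sum_(i < k) \sum_(j < 1) (x - p) i j ^+ 2).
  apply: continuous_big => [|i _]; first exact: add_continuous.
  apply: continuous_big => [|j _]; first exact: add_continuous.
  exact: c.
by move=> x; apply: (continuous_comp (csum x)); exact: sqrt_continuous.
Qed.

(** * Edge lengths of a displacement *)

Lemma dot_pt (R : realType) (n d : nat) (v : 'cV[R]_(n * d)) :
  dot v v = \sum_(i < n) dot (pt v i) (pt v i).
Proof.
rewrite /dot pair_big /= (reindex _ (curry_mxvec_bij n d)) /=.
by apply: eq_bigr => -[i a] _ /=; rewrite !mxE.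
Qed.

(** Each vertex is an end of at most [max_degree G] edges; the strict order in
    [edges] keeps an edge from being counted twice. *)
Lemma sum_edge_ends_le (R : realType) (n : nat) (G : rel 'I_n)
    (Gsym : symmetric G) (f : 'I_n -> R) (f0 : forall i, 0 <= f i) :
  \sum_(k < nedges G) (f (edge k).1 + f (edge k).2)
    <= (max_degree G)%:R * \sum_i f i.
Proof.
pose F (e : 'I_n * 'I_n) := f e.1 + f e.2.
rewrite -(big_enum_val F) /=.
have -> : \sum_(e in edges G) F e =
    \sum_(i < n) \sum_(j < n) ((i < j)%N && G i j)%:R * f i
    + \sum_(i < n) \sum_(j < n) ((i < j)%N && G i j)%:R * f j.
  rewrite big_mkcond -big_split /F /=.
  under [RHS]eq_bigr do rewrite -big_split.
  rewrite pair_big /=; apply: eq_bigr => -[i j] _; rewrite inE /=.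
  by case: ifP => _; rewrite ?mul1r ?mul0r ?addr0.
rewrite [X in _ + X]exchange_big -big_split mulr_sumr /=.
apply: ler_sum => i _; rewrite -big_split /=.
apply: (@le_trans _ _ (\sum_j (G i j)%:R * f i)).
  apply: ler_sum => j _; rewrite -mulrDl ler_wpM2r // -natrD ler_nat.
  by rewrite [G j i]Gsym; case: ltngtP; case: (G i j).
rewrite -mulr_suml ler_wpM2r // -natr_sum ler_nat.
apply: leq_trans (leq_bigmax i); rewrite -sum1_card [leqRHS]big_mkcond /=.
(* the neighbourhood in [max_degree] is a classical set, so membership in it is
   a reflected proposition *)
by apply: leq_sum => j _; rewrite unfold_in /in_set asboolb; case: (G i j).
Qed.

(** Each [|v_e|^2] is at most [2 * |v|^2], since the two ends of [e] are distinct
    vertices, and the sum of all [|v_e|^2] is at most [2 * z * |v|^2], where [z]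
    is the maximum degree, since each vertex is counted at most [z] times. *)
Lemma sum_edge_pow4_le (R : realType) (n d : nat) (G : rel 'I_n)
    (Gsym : symmetric G) (v : 'cV[R]_(n * d)) :
  \sum_(k < nedges G) dot (ediff v k) (ediff v k) ^+ 2
    <= 4 * (max_degree G)%:R * dot v v ^+ 2.
Proof.
have s0 i : 0 <= dot (pt v i) (pt v i) by exact: dot_ge0.
apply: (@le_trans _ _ (\sum_(k < nedges G) 4 * dot v v *
    (dot (pt v (edge k).1) (pt v (edge k).1)
     + dot (pt v (edge k).2) (pt v (edge k).2)))).
  apply: ler_sum => k _.
  have le1 : dot (ediff v k) (ediff v k) <=
      2 * (dot (pt v (edge k).1) (pt v (edge k).1)
           + dot (pt v (edge k).2) (pt v (edge k).2)) by exact: dot_sqrB_le.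
  have le2 : dot (pt v (edge k).1) (pt v (edge k).1)
           + dot (pt v (edge k).2) (pt v (edge k).2) <= dot v v.
    have ne : (edge k).2 != (edge k).1.
      have : edge k \in edges G by exact: enum_valP.
      rewrite inE => /andP[lt12 _]; apply: contraTneq lt12 => ->.
      by rewrite ltnn.
    rewrite dot_pt (bigD1 (edge k).1) //= (bigD1 (edge k).2) //= addrA lerDl.
    exact: sumr_ge0.
  have e0 := dot_ge0 (ediff v k); have s1 := s0 (edge k).1.
  have s2 := s0 (edge k).2; move: le1 le2 e0 s1 s2.
  by nra.
rewrite -mulr_sumr; have := sum_edge_ends_le Gsym s0; rewrite -dot_pt => H.
by apply: le_trans (ler_wpM2l _ H) _; rewrite ?mulr_ge0 ?dot_ge0 //; nra.
Qed.

(** * Displacements that preserve edge lengths *)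

(** The coordinates of [v] in the basis, the form in which [kappa_admissible]
    can be applied to a vector of the subspace. *)
Lemma orthonormal_basis_coord (R : realType) (k : nat) (U : {vspace 'cV[R]_k})
    (B : 'M[R]_(k, \dim U)) (v : 'cV[R]_k) :
  orthonormal_basis B -> v \in U -> exists2 x, v = B *m x & dot x x = dot v v.
Proof.
move=> [BTB /andP[/eqP spanU _]] vU.
have [x vE] : exists x, v = B *m x.
  pose X := [tuple of [seq col j B | j <- ord_tuple (\dim U)]].
  have vX : v \in <<X>>%VS by rewrite spanU.
  exists (\col_j coord X j v).
  rewrite [LHS](coord_span vX); apply/colP => i; rewrite summxE mxE.
  apply: eq_bigr => j _.
  by rewrite (nth_map j) ?size_enum_ord // nth_ord_enum !mxE mulrC.
exists x => //; rewrite vE !dot_mulmx trmx_mul mulmxA -(mulmxA x^T) BTB.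
by rewrite mulmx1.
Qed.

(** Squared lengths are quadratic in [v], so when they do not change, the linear
    part of the change is exactly minus the quadratic part. *)
Lemma rigidity_mx_preserving (R : realType) (n d : nat) (G : rel 'I_n)
    (p v : 'cV[R]_(n * d)) (k : 'I_(nedges G)) :
  enorm (ediff (p + v) k) = enorm (ediff p k) ->
  (rigidity_mx G p *m v) k 0 = - (dot (ediff v k) (ediff v k) / 2).
Proof.
have ptD i : pt (p + v) i = pt p i + pt v i by apply/colP => a; rewrite !mxE.
have ediffD : ediff (p + v) k = ediff p k + ediff v k.
  by rewrite /ediff !ptD opprD addrACA.
move=> /(congr1 (fun x => x ^+ 2)); rewrite !sqr_enorm ediffD dot_sqrD.
by rewrite rigidity_mxE -/(ediff p k) -/(ediff v k); lra.
Qed.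

(** The linear and quadratic parts cancel on each edge, hence also in the sum
    weighted by any stress: the energy becomes linear in [v]. *)
Lemma stress_form_preserving (R : realType) (n d : nat) (G : rel 'I_n)
    (p v : 'cV[R]_(n * d)) (omega : 'cV[R]_(nedges G)) :
  (forall k : 'I_(nedges G), enorm (ediff (p + v) k) = enorm (ediff p k)) ->
  (v^T *m stress_mx d omega *m v) 0 0 =
  - 2 * (omega^T *m rigidity_mx G p *m v) 0 0.
Proof.
move=> len; rewrite stress_mxE -mulmxA [in RHS]mxE mulr_sumr.
apply: eq_bigr => k _; rewrite (rigidity_mx_preserving (len k)) mxE.
by rewrite -/(ediff v k); field.
Qed.

Lemma kappa_admissible_form (R : realType) (n d : nat) (G : rel 'I_n)
    (p : 'cV[R]_(n * d)) (omega : 'cV[R]_(nedges G))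
    (U : {vspace 'cV[R]_(n * d)}) (C : 'M[R]_(n * d, \dim U))
    (lambda kappa : R) (v : 'cV[R]_(n * d)) :
  orthonormal_basis C -> kappa_admissible p omega C lambda kappa -> v \in U ->
  lambda * dot v v <= (v^T *m stress_mx d omega *m v) 0 0
    + 2 * kappa * dot (rigidity_mx G p *m v) (rigidity_mx G p *m v).
Proof.
move=> hC [_ hpsd] vU; have [x vE <-] := orthonormal_basis_coord hC vU.
have DE (M N : 'M[R]_1) : (M + N) 0 0 = M 0 0 + N 0 0 by rewrite mxE.
have NE (M : 'M[R]_1) : (- M) 0 0 = - M 0 0 by rewrite mxE.
have ZE a (M : 'M[R]_1) : (a *: M) 0 0 = a * M 0 0 by rewrite mxE.
have := hpsd x; rewrite mulmxBr mulmxBl mulmxDr mulmxDl.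
rewrite -scalemxAr -scalemxAl mul_mx_scalar -scalemxAl DE NE DE !ZE !dot_mulmx.
by rewrite vE !trmx_mul !mulmxA; lra.
Qed.

(** The right-hand side has no quadratic term, since the stress energy has become
    linear in [v] and the penalty [|R(p) v|^2] quartic: this is what separates
    small displacements from large ones. *)
Lemma preserving_growth (R : realType) (n d : nat) (G : rel 'I_n)
    (Gsym : symmetric G) (p : 'cV[R]_(n * d)) (omega : 'cV[R]_(nedges G))
    (U : {vspace 'cV[R]_(n * d)}) (C : 'M[R]_(n * d, \dim U))
    (lambda kappa : R) (v : 'cV[R]_(n * d)) :
  orthonormal_basis C -> kappa_admissible p omega C lambda kappa -> v \in U ->
  (forall k : 'I_(nedges G), enorm (ediff (p + v) k) = enorm (ediff p k)) ->
  lambda * enorm v ^+ 2 <= 2 * enorm (omega^T *m rigidity_mx G p) * enorm v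
    + 2 * (max_degree G)%:R * kappa * enorm v ^+ 4.
Proof.
move=> hC hk vU len; have kappa0 : 0 <= kappa by case: hk.
have := kappa_admissible_form hC hk vU; rewrite (stress_form_preserving _ len).
have -> : dot (rigidity_mx G p *m v) (rigidity_mx G p *m v) =
    (\sum_(k < nedges G) dot (ediff v k) (ediff v k) ^+ 2) / 4.
  rewrite mulr_suml; apply: eq_bigr => k _.
  by rewrite (rigidity_mx_preserving (len k)); field.
have := sum_edge_pow4_le Gsym v; set S := \sum_k _ => hS.
have -> : enorm v ^+ 4 = dot v v ^+ 2 by rewrite -sqr_enorm -exprM.
have := mulmx_enorm_le (omega^T *m rigidity_mx G p) v.
rewrite ler_norml => /andP[hW _] hform; rewrite sqr_enorm.
by have := ler_wpM2l kappa0 hS; move: hform hW; lra.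
Qed.

(** * The forbidden gap *)

Lemma Linv_Lscale_ge0 (R : realType) (z : nat) (lambda kappa : R) :
  0 <= Linv (Lscale z lambda kappa).
Proof. by rewrite /Lscale; case: eqP => //= _; rewrite invr_ge0 sqrtr_ge0. Qed.

(** [L^2 = lambda / (8 z kappa)] without division, so that the degenerate cases
    [kappa = 0] and [z = 0], in which [Linv] is [0], are covered as well. *)
Lemma Linv_Lscale (R : realType) (z : nat) (lambda kappa : R) :
  0 < lambda -> 0 <= kappa ->
  lambda * Linv (Lscale z lambda kappa) ^+ 2 = 8 * z%:R * kappa.
Proof.
move=> l0 k0; rewrite /Lscale; case: eqP => [->|_] /=.
  by rewrite expr0n /= !mulr0.
rewrite exprVn sqr_sqrtr; last by rewrite divr_ge0 ?mulr_ge0 // ltW.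
by rewrite invf_div mulrCA divff ?mulr1 // gt_eqF.
Qed.

Theorem theorem1 (R : realType) (n d : nat)
  (G : rel 'I_n) (Gsym : symmetric G) (Girr : irreflexive G)
  (p : 'cV[R]_(n * d))
  (CC : {vspace 'cV[R]_(n * d)})
  (hCC : complementary CC (trivial_flexes p))
  (VV : {vspace 'cV[R]_(n * d)})
  (hnullVV : forall v, rigidity_mx G p *m v = 0 -> v \in CC -> v \in VV)
  (hVVCC : (VV <= CC)%VS)
  (omega : 'cV[R]_(nedges G))
  (V : 'M[R]_(n * d, \dim VV)) (hV : orthonormal_basis V)
  (hpos : posdef (V^T *m stress_mx d omega *m V))
  (C : 'M[R]_(n * d, \dim CC)) (hC : orthonormal_basis C)
  (lambda : R) (hlambda0 : 0 < lambda)
  (hlambda : (lambda%:E < lambda_min (V^T *m stress_mx d omega *m V))%E)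
  (kappa : R) (hkappa : is_min_kappa p omega C lambda kappa) :
  let mu0 := lambda_min (C^T *m stress_mx d omega *m C) in
  let L := Lscale (max_degree G) lambda kappa in
  let eta1 := 4 * enorm (omega^T *m rigidity_mx G p) / lambda in
  let D := eta1 * Linv L * (Num.sqrt (mubar mu0 lambda) + eta1 * Linv L) in
  D < 1 / 2 ->
  forall (I : interval R) (q : R -> 'cV[R]_(n * d)),
    0 \in I ->
    {within [set` I], continuous q} ->
    (forall t, t \in I -> translate p CC (q t)) ->
    q 0 = p ->
    (forall t, t \in I -> forall k : 'I_(nedges G),
       enorm (pt (q t) (edge k).1 - pt (q t) (edge k).2) =
       enorm (pt p (edge k).1 - pt p (edge k).2)) ->
    forall t, t \in I -> enorm (q t - p) <= eta1.
Proof.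
move=> mu0 L eta1 D hD I q I0 qcont qCC q0 qlen t tI.
have [kappa0 _] := hkappa.1.
set l := Linv L in D hD.
have l0 : 0 <= l by exact: Linv_Lscale_ge0.
have eta10 : 0 <= eta1 by rewrite divr_ge0 ?mulr_ge0 ?enorm_ge0 // ltW.
have etal : eta1 * l < 1.
  have el0 : 0 <= eta1 * l by rewrite mulr_ge0.
  have := sqrtr_ge0 (mubar mu0 lambda); move: hD; rewrite /D.
  by nra.
(* the gap: a displacement of norm at most [L] has norm at most [eta1] *)
have small s : s \in I -> enorm (q s - p) * l <= 1 -> enorm (q s - p) <= eta1.
  move=> sI; have [v vCC qE] := qCC s sI.
  have -> : q s - p = v by rewrite -qE addrC addKr.
  have len (k : 'I_(nedges G)) : enorm (ediff (p + v) k) = enorm (ediff p k).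
    by have := qlen s sI k; rewrite -qE.
  have := preserving_growth Gsym hC hkappa.1 vCC len.
  have := Linv_Lscale (max_degree G) hlambda0 kappa0; rewrite -/L -/l.
  have -> : enorm (omega^T *m rigidity_mx G p) = eta1 * lambda / 4.
    by rewrite /eta1; field; rewrite gt_eqF.
  have := enorm_ge0 v; set c := enorm v => c0 hl hc cl.
  rewrite leNgt; apply/negP => eta_lt.
  have c_gt0 : 0 < c by exact: le_lt_trans eta_lt.
  have cl2 : (c * l) ^+ 2 <= 1 by rewrite expr_le1 ?mulr_ge0.
  (* by [c * l <= 1] the quartic term is at most [lambda * c ^+ 2 / 4] *)
  have : lambda * c ^+ 2 * 3 / 4 <= lambda * eta1 * c / 2.
    have -> : lambda * eta1 * c / 2 = 2 * (eta1 * lambda / 4) * c by field.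
    have : lambda * c ^+ 2 * (c * l) ^+ 2 <= lambda * c ^+ 2.
      by rewrite ler_piMr // mulr_ge0 ?sqr_ge0 // ltW.
    have -> : lambda * c ^+ 2 * (c * l) ^+ 2 = (lambda * l ^+ 2) * c ^+ 4.
      by ring.
    by rewrite hl; lra.
  have -> : lambda * eta1 * c / 2 = lambda * c * (eta1 / 2) by field.
  have -> : lambda * c ^+ 2 * 3 / 4 = lambda * c * (c * 3 / 4) by field.
  by rewrite ler_pM2l ?mulr_gt0 //; lra.
have [tl|tl] := lerP (enorm (q t - p) * l) 1; first exact: small.
have l_gt0 : 0 < l.
  by rewrite lt_def l0 andbT; apply: contraTneq tl => ->; rewrite mulr0 ltr10.
(* otherwise the path would reach norm exactly [L = l^-1], inside the gap *)
have Iconn : connected [set` I].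
  exact/connected_intervalP/interval_is_interval.
have /connected_intervalP img : connected
    ((fun x => enorm (x - p)) @` (q @` [set` I])).
  apply: connected_continuous_connected.
    exact: connected_continuous_connected qcont.
  exact/continuous_subspaceT/enorm_continuous.
have dist0 : ((fun x => enorm (x - p)) @` (q @` [set` I])) 0.
  exists (q 0); first by exists 0.
  rewrite q0 subrr /enorm big1 ?sqrtr0 // => i _; rewrite big1 // => j _.
  by rewrite mxE expr0n.
have distt : ((fun x => enorm (x - p)) @` (q @` [set` I])) (enorm (q t - p)).
  by exists (q t) => //; exists t.
have [|_ [s sI <-] sE] := img _ _ dist0 distt l^-1.
  by rewrite invr_ge0 l0 ltW // -(ltr_pM2r l_gt0) mulVf ?gt_eqF.
have := small s sI.
rewrite sE mulVf ?gt_eqF // => /(_ (lexx _)).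
by rewrite -(ler_pM2r l_gt0) mulVf ?gt_eqF // leNgt etal.
Qed.
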